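(* Let $K=\overline{\mathbb Q}$ and let $r,s,u\in K$ be such that the plane quartic $$X_4:\ x^4+y^4+z^4+rx^2y^2+sy^2z^2+uz^2x^2=0$$ in $\mathbb P^2_K$ is smooth. Then all the 28 bitangents of $X_4$ have symbolic solutions: each of the 28 bitangent lines of $X_4$ can be written as $ax+by+cz=0$ with $(a,b,c)\neq(0,0,0)$ and $a,b,c$ expressible by radicals in terms of $r,s,u$.
   Context: A line $L\subset\mathbb P^2_K$ is a bitangent of a smooth plane quartic $f(x,y,z)=0$ if the restriction of $f$ to $L$ is the square of a quadratic form on $L$ (for $L: ax+by+z=0$ this means $f(x,y,-ax-by)=(\lambda_0x^2+\lambda_1xy+\lambda_2y^2)^2$ for some $\lambda_0,\lambda_1,\lambda_2\in K$). A smooth plane quartic over $K$ has exactly 28 bitangents. An element of $K$ is expressible by radicals in terms of $r,s,u$ if it lies in a field $F_m\subset K$ at the top of a tower $\mathbb Q(r,s,u)=F_0\subset F_1\subset\cdots\subset F_m$ with $F_{i+1}=F_i(t_i)$ and $t_i^{n_i}\in F_i$ for some $n_i\geq 1$. *)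

(* Defs.v *)
From mathcomp Require Import all_boot all_order all_algebra all_field.
From mathcomp Require Import mpoly.

Set Implicit Arguments.
Unset Strict Implicit.
Unset Printing Implicit Defensive.

Import GRing.Theory.
Local Open Scope ring_scope.

(* [algC] is the field of algebraic numbers.  Homogeneous coordinates are     *)
(* (x, y, z) = ('X_0, 'X_1, 'X_2), and a point of the plane is represented by *)
(* a nonzero row vector.                                                      *)

Definition quartic (r s u : algC) : {mpoly algC[3]} :=
  let x := 'X_(0 : 'I_3) in let y := 'X_(1 : 'I_3) in let z := 'X_(2 : 'I_3) in
  x ^+ 4 + y ^+ 4 + z ^+ 4
    + r *: (x ^+ 2 * y ^+ 2) + s *: (y ^+ 2 * z ^+ 2) + u *: (z ^+ 2 * x ^+ 2).

(* Jacobian criterion; checking the [algC]-points suffices since [algC] is    *)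
(* algebraically closed.                                                      *)
Definition smooth_curve (f : {mpoly algC[3]}) : Prop :=
  forall p : 'rV[algC]_3, p != 0 -> f.@[p 0] = 0 ->
  exists i : 'I_3, (f^`M(i)).@[p 0] != 0.

(* A line of the projective plane is a two-dimensional subspace L of the      *)
(* space of row vectors.  Every quadratic form on L is the restriction of a   *)
(* ternary one, and, [algC] being infinite, forms on L agree as soon as their *)
(* values do.                                                                 *)
Definition bitangent (f : {mpoly algC[3]}) (L : {vspace 'rV[algC]_3}) : Prop :=
  \dim L = 2%N /\
  exists2 q : {mpoly algC[3]}, q \is 2.-homog &
    forall p, p \in L -> f.@[p 0] = q.@[p 0] ^+ 2.

Definition line_eqn (L : {vspace 'rV[algC]_3}) (a b c : algC) : Prop :=
  forall p : 'rV[algC]_3,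
    (p \in L) <-> a * p 0 0 + b * p 0 1 + c * p 0 2 = 0.

Inductive gen_subfield (S : algC -> Prop) : algC -> Prop :=
| gen_base x of S x : gen_subfield S x
| gen_one : gen_subfield S 1
| gen_sub x y of gen_subfield S x & gen_subfield S y : gen_subfield S (x - y)
| gen_mul x y of gen_subfield S x & gen_subfield S y : gen_subfield S (x * y)
| gen_inv x of gen_subfield S x : gen_subfield S x^-1.

Definition adjoin (F : algC -> Prop) (t : algC) : algC -> Prop :=
  gen_subfield (fun x => F x \/ x = t).

Inductive radical_tower (F0 : algC -> Prop) : (algC -> Prop) -> Prop :=
| tower_base : radical_tower F0 F0
| tower_step F t n of radical_tower F0 F & (0 < n)%N & F (t ^+ n) :
    radical_tower F0 (adjoin F t).

(* A subfield of [algC] contains the rationals, so the subfield generated by  *)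
(* r, s and u is Q(r, s, u).                                                  *)
Definition radical_expr (r s u x : algC) : Prop :=
  exists2 F : algC -> Prop,
    radical_tower (gen_subfield (fun y => y \in [:: r; s; u])) F & F x.

(* Main.v *)
(* In the chart z = - a x - b y with a b <> 0, comparing coefficients in
   f(x, y, - a x - b y) = (l0 x^2 + l1 x y + l2 y^2)^2 gives, with nu = l1 / (a b),
   l0 nu = 2 a^2 + u, l2 nu = 2 b^2 + s, hence l0^2 (nu^2 - 4) = u^2 - 4 and
   l2^2 (nu^2 - 4) = s^2 - 4.  So 2 a^2 = t U - u and 2 b^2 = t S - s for square
   roots U, S of u^2 - 4, s^2 - 4, where the remaining equation becomes quadratic
   in t with discriminant 16 (r^2 - 4).  Up to a common sign change there are four
   choices of the square roots R, S, U, and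
     a^2 = (R U + r u - 2 s) / (U S + u s - 2 r),
     b^2 = (R S + r s - 2 u) / (U S + u s - 2 r);
   these give 4 * 4 = 16 bitangents.  On a line through exactly one coordinate vertex
   the restriction of f is biquadratic, so bitangency is the vanishing of a
   discriminant, an even quartic equation with four roots: 3 * 4 = 12 bitangents.
   Smoothness means that r^2, s^2, u^2 differ from 4 and that the conic obtained by
   replacing x^2, y^2, z^2 with coordinates is nondegenerate; this is what keeps the
   28 lines distinct and excludes the coordinate lines. *)

Require Import Defs.
From mathcomp Require Import all_boot all_order all_algebra all_field.
From mathcomp Require Import mpoly ring.

Set Implicit Arguments.
Unset Strict Implicit.
Unset Printing Implicit Defensive.

Import Order.TTheory GRing.Theory Num.Theory.
Local Open Scope ring_scope.

(** * Squares among binary quartic forms *)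

(** The points (1, 0) and (0, 1) give the outer coefficients. The values at (1, 1), (1, -1) and (1,
    2) then give a linear system for the errors [dB], [dC], [dD] that is invertible in
    characteristic 0. *)
Lemma binary_quartic_squareP (K : numFieldType) (A B C D E l0 l1 l2 : K) :
  (forall x y, A * x ^+ 4 + B * (x ^+ 3 * y) + C * (x ^+ 2 * y ^+ 2)
       + D * (x * y ^+ 3) + E * y ^+ 4
     = (l0 * x ^+ 2 + l1 * (x * y) + l2 * y ^+ 2) ^+ 2) <->
  [/\ A = l0 ^+ 2, B = 2 * (l0 * l1), C = l1 ^+ 2 + 2 * (l0 * l2),
      D = 2 * (l1 * l2) & E = l2 ^+ 2].
Proof.
split=> [h | [-> -> -> -> ->] x y]; last by ring.
have hA : A = l0 ^+ 2 by have := h 1 0; rewrite !(expr0n, expr1n) /= => e; ring: e.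
have hE : E = l2 ^+ 2 by have := h 0 1; rewrite !(expr0n, expr1n) /= => e; ring: e.
subst A E.
have h1 := h 1 1; have h2 := h 1 (-1); have h3 := h 1 2.
pose dB := B - 2 * (l0 * l1); pose dC := C - (l1 ^+ 2 + 2 * (l0 * l2)).
pose dD := D - 2 * (l1 * l2).
have e1 : dB + dC + dD = 0.
  by move/eqP: h1; rewrite -subr_eq0 => /eqP <-; rewrite /dB /dC /dD; ring.
have e2 : dC - dB - dD = 0.
  by move/eqP: h2; rewrite -subr_eq0 => /eqP <-; rewrite /dB /dC /dD; ring.
have e3 : 2 * dB + 4 * dC + 8 * dD = 0.
  by move/eqP: h3; rewrite -subr_eq0 => /eqP <-; rewrite /dB /dC /dD; ring.
have zC : dC = 0.
  have -> : dC = ((dB + dC + dD) + (dC - dB - dD)) / 2 by field.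
  by rewrite e1 e2 addr0 mul0r.
have zD : dD = 0.
  have -> : dD = ((2 * dB + 4 * dC + 8 * dD) - 2 * (dB + dC + dD) - 2 * dC) / 6.
    by field.
  by rewrite e1 e3 zC mulr0 !subr0 mul0r.
have zB : dB = 0 by move: e1; rewrite zC zD !addr0.
by split=> //; apply/eqP; rewrite -subr_eq0; apply/eqP.
Qed.

(** Since [y ^+ 4] has coefficient 1, [l2] is nonzero, so the missing [x * y ^+ 3] term forces
    [l1 = 0]. Conversely one completes the square. *)
Lemma biquadratic_squareP (K : numClosedFieldType) (A C : K) :
  (exists l0 l1 l2, forall x y,
     A * x ^+ 4 + C * (x ^+ 2 * y ^+ 2) + y ^+ 4
       = (l0 * x ^+ 2 + l1 * (x * y) + l2 * y ^+ 2) ^+ 2) <->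
  C ^+ 2 = 4 * A.
Proof.
split=> [[l0 [l1 [l2 h]]] | h].
  have /binary_quartic_squareP[hA hB hC hD hE] : forall x y : K,
      A * x ^+ 4 + 0 * (x ^+ 3 * y) + C * (x ^+ 2 * y ^+ 2)
        + 0 * (x * y ^+ 3) + 1 * y ^+ 4
      = (l0 * x ^+ 2 + l1 * (x * y) + l2 * y ^+ 2) ^+ 2.
    by move=> x y; rewrite -h; ring.
  have n2 : l2 != 0.
    by apply/eqP => l20; move: hE; rewrite l20 expr0n => /eqP; rewrite oner_eq0.
  have l10 : l1 = 0.
    move/esym/eqP: hD; rewrite !mulf_eq0 pnatr_eq0 (negPf n2) orbF /=.
    by move/eqP.
  by rewrite hC hA l10; ring: (esym hE).
exists (C / 2), 0, 1 => x y.
have -> : A = C ^+ 2 / 4 by rewrite h; field.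
by field.
Qed.

(** As a quadratic in [m ^+ 2] it has two distinct roots by the discriminant, both nonzero because
    of [D]; each has two opposite square roots. *)
Lemma even_quartic_roots (K : numClosedFieldType) (A B D : K) :
  A != 0 -> D != 0 -> B ^+ 2 - 4 * A * D != 0 ->
  exists ms : seq K, [/\ uniq ms, size ms = 4%N &
    forall m, m \in ms <-> A * m ^+ 4 + B * m ^+ 2 + D = 0].
Proof.
move=> A0 D0; set d := sqrtC (B ^+ 2 - 4 * A * D).
have dK : d ^+ 2 = B ^+ 2 - 4 * A * D by rewrite sqrtCK.
rewrite -dK sqrf_eq0 => d0.
pose v := sqrtC ((- B + d) / (2 * A)); pose w := sqrtC ((- B - d) / (2 * A)).
have vK : v ^+ 2 = (- B + d) / (2 * A) by rewrite sqrtCK.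
have wK : w ^+ 2 = (- B - d) / (2 * A) by rewrite sqrtCK.
have fact m : A * m ^+ 4 + B * m ^+ 2 + D
    = A * ((m - v) * (m + v)) * ((m - w) * (m + w)).
  rewrite -!subr_sqr vK wK.
  have -> : D = (B ^+ 2 - d ^+ 2) / (4 * A) by rewrite dK; field.
  by field.
have vw : v ^+ 2 - w ^+ 2 != 0.
  have -> : v ^+ 2 - w ^+ 2 = d / A by rewrite vK wK; field.
  by rewrite mulf_neq0 ?invr_eq0.
have : v ^+ 2 * w ^+ 2 != 0.
  have -> : v ^+ 2 * w ^+ 2 = D / A.
    have -> : D = (B ^+ 2 - d ^+ 2) / (4 * A) by rewrite dK; field.
    by rewrite vK wK; field.
  by rewrite mulf_neq0 ?invr_eq0.
rewrite mulf_eq0 !sqrf_eq0 => /norP[v0 w0].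
exists [:: v; - v; w; - w]; split=> //= [|m].
  rewrite !inE !negb_or !andbT.
  move: vw; rewrite subr_sqr mulf_eq0 => /norP[vw vw'].
  have nz (z : K) : z != 0 -> z != - z.
    by move=> z0; rewrite -subr_eq0 opprK -mulr2n mulrn_eq0.
  rewrite subr_eq0 in vw; rewrite addr_eq0 in vw'.
  by rewrite !nz // eqr_opp eqr_oppLR vw vw'.
rewrite fact !inE; split=> [h | /eqP].
  apply/eqP; rewrite !mulf_eq0 (negPf A0) /= !subr_eq0 !addr_eq0.
  by rewrite -!orbA.
by rewrite !mulf_eq0 (negPf A0) /= !subr_eq0 !addr_eq0 -!orbA.
Qed.

(** Four sign pairs act on one chosen pair of roots. Nonzero coordinates allow the signs to be
    recovered by cancellation, which keeps the pairs distinct. *)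
Lemma pair_square_roots (K : numClosedFieldType) (ws : seq (K * K)) :
  uniq ws -> (forall w, w \in ws -> (w.1 != 0) && (w.2 != 0)) ->
  exists abs : seq (K * K), [/\ uniq abs, size abs = (4 * size ws)%N &
    forall a b, (a, b) \in abs <-> (a ^+ 2, b ^+ 2) \in ws].
Proof.
move=> uws nzws.
pose signs : seq (K * K) := [:: (1, 1); (1, -1); (-1, 1); (-1, -1)].
pose root (w e : K * K) := (e.1 * sqrtC w.1, e.2 * sqrtC w.2).
have n1 : (1 : K) != -1 by rewrite -subr_eq0 opprK -mulr2n pnatr_eq0.
have signK e : e \in signs -> e.1 ^+ 2 = 1 /\ e.2 ^+ 2 = 1.
  by rewrite !inE => /or4P[] /eqP ->; rewrite /= ?sqrrN !expr1n.
have rootK w e : e \in signs ->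
    ((root w e).1 ^+ 2, (root w e).2 ^+ 2) = w.
  by case/signK=> e1 e2; rewrite /root /= !exprMn e1 e2 !mul1r !sqrtCK; case: w.
exists [seq root w e | w <- ws, e <- signs]; split; last 1 first.
- move=> a b; split=> [/allpairsP[[w e] /= [ww es ab]] | abw].
    by have := rootK w e es; rewrite -ab /= => ->.
  have sgn (c : K) : exists2 e, (e == 1) || (e == -1) & c = e * sqrtC (c ^+ 2).
    have : c ^+ 2 == sqrtC (c ^+ 2) ^+ 2 by rewrite sqrtCK.
    rewrite eqf_sqr => /orP[] /eqP h.
      by exists 1; rewrite ?eqxx // mul1r.
    by exists (-1); rewrite ?eqxx ?orbT // mulN1r.
  have [e1 s1 ea] := sgn a; have [e2 s2 eb] := sgn b.
  apply/allpairsP; exists ((a ^+ 2, b ^+ 2), (e1, e2)); split=> //=.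
    by rewrite !inE !xpair_eqE; move: s1 s2 => /orP[] -> /orP[] ->; rewrite ?orbT.
  by rewrite /root /= -ea -eb.
- apply: allpairs_uniq => //.
    rewrite /= !inE !xpair_eqE !eqxx /=.
    by rewrite ![_ == 1]eq_sym (negPf n1).
  move=> [w e] [w' e'] /allpairsP[p [ww es [ew ee]]].
  case/allpairsP=> p' [ww' es' [ew' ee']] /= h.
  rewrite -{}ee in es; rewrite -{}ee' in es'; rewrite -{}ew in ww.
  rewrite -{}ew' in ww'.
  have ew : w = w' by rewrite -(rootK w e es) -(rootK w' e' es') h.
  rewrite -ew in h *; congr (_, _); case: h.
  case/andP: (nzws _ ww) => w1 w2.
  move=> /mulIf h1 /mulIf h2.
  by case: e e' h1 h2 {es es'} => [? ?] [? ?] /= h1 h2;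
     rewrite h1 ?sqrtC_eq0 // h2 // sqrtC_eq0.
- by rewrite size_allpairs mulnC.
Qed.

(** * The lines that miss the coordinate vertices *)

(* The normal (a, b, 1) of a bitangent with a b <> 0 satisfies
   (a ^ 2, b ^ 2) = normal_squares r s u R S U for suitable square roots R, S, U
   of r ^ 2 - 4, s ^ 2 - 4, u ^ 2 - 4. *)
Definition normal_squares (K : fieldType) (r s u R S U : K) : K * K :=
  ((R * U + r * u - 2 * s) / (U * S + u * s - 2 * r),
   (R * S + r * s - 2 * u) / (U * S + u * s - 2 * r)).

(** The product with the conjugate [U * S - u * s + 2 * r] is -4 times the hypothesis, which is the
    determinant of the conic up to a constant. *)
Lemma normal_squares_denom_neq0 (K : numFieldType) (r s u S U : K) :
  S ^+ 2 = s ^+ 2 - 4 -> U ^+ 2 = u ^+ 2 - 4 ->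
  r ^+ 2 + s ^+ 2 + u ^+ 2 - r * s * u - 4 != 0 ->
  U * S + u * s - 2 * r != 0.
Proof.
move=> hS hU; apply: contra_neq => h0.
have : (U * S - u * s + 2 * r) * (U * S + u * s - 2 * r)
    = - 4 * (r ^+ 2 + s ^+ 2 + u ^+ 2 - r * s * u - 4) by ring: hS hU.
rewrite h0 mulr0 => /esym/eqP.
by rewrite mulf_eq0 oppr_eq0 pnatr_eq0 /= => /eqP.
Qed.

(* Comparison of the coefficients of f(x, y, - a x - b y), for f the quartic,
   and of (l0 x ^ 2 + l1 x y + l2 y ^ 2) ^ 2. *)
Definition square_eqns (K : fieldType) (r s u a b l0 l1 l2 : K) : Prop :=
  [/\ 1 + u * a ^+ 2 + a ^+ 4 = l0 ^+ 2,
      4 * a ^+ 3 * b + 2 * u * a * b = 2 * (l0 * l1),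
      6 * a ^+ 2 * b ^+ 2 + r + s * a ^+ 2 + u * b ^+ 2
        = l1 ^+ 2 + 2 * (l0 * l2),
      4 * a * b ^+ 3 + 2 * s * a * b = 2 * (l1 * l2) &
      1 + s * b ^+ 2 + b ^+ 4 = l2 ^+ 2].

Lemma sqr_eq (K : idomainType) (x y z : K) :
  x ^+ 2 = z -> y ^+ 2 = z -> x = y \/ x = - y.
Proof.
by move=> hx hy; have /eqP := etrans hx (esym hy); rewrite eqf_sqr => /orP[] /eqP; auto.
Qed.

Section Generic.
Context {K : numClosedFieldType} (r s u : K).
Context (hu : u ^+ 2 - 4 != 0) (hs : s ^+ 2 - 4 != 0) (hr : r ^+ 2 - 4 != 0).
Context (hdet : r ^+ 2 + s ^+ 2 + u ^+ 2 - r * s * u - 4 != 0).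

(* The parameter t is l1 / (a b k), where k = U / l0 = S / l2 in [square_eqns]:
   these equations say that 2 a ^ 2 + u = t U, 2 b ^ 2 + s = t S and that t is a
   root of a quadratic polynomial of discriminant 16 R ^ 2. *)
Lemma normal_squares_param R S U t :
  R ^+ 2 = r ^+ 2 - 4 -> S ^+ 2 = s ^+ 2 - 4 -> U ^+ 2 = u ^+ 2 - 4 ->
  t = (U * s + u * S + 2 * R) / (U * S + u * s - 2 * r) ->
  normal_squares r s u R S U = ((t * U - u) / 2, (t * S - s) / 2) /\
  t ^+ 2 * (U * S + u * s - 2 * r) = 2 * t * (U * s + u * S) - (U * S + u * s + 2 * r).
Proof.
move=> hR hS hU ->; have D0 := normal_squares_denom_neq0 hS hU hdet.
rewrite /normal_squares; set D := U * S + u * s - 2 * r in D0 *.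
have scale (x y : K) : x * D = y * D -> x = y by apply: mulIf.
split; first congr (_, _); apply: scale.
- rewrite (_ : _ / D * D = R * U + r * u - 2 * s); last by field.
  rewrite (_ : _ * D = ((U * s + u * S + 2 * R) * U - u * D) / 2); last by field.
  rewrite (_ : _ - u * D = 2 * (R * U + r * u - 2 * s)); first by field.
  by rewrite /D; ring: hU.
- rewrite (_ : _ / D * D = R * S + r * s - 2 * u); last by field.
  rewrite (_ : _ * D = ((U * s + u * S + 2 * R) * S - s * D) / 2); last by field.
  rewrite (_ : _ - s * D = 2 * (R * S + r * s - 2 * u)); first by field.
  by rewrite /D; ring: hS.
- set X := U * s + u * S.
  rewrite (_ : _ ^+ 2 * D * D = (X + 2 * R) ^+ 2); last by field.
  rewrite (_ : _ * D = 2 * (X + 2 * R) * X - (D + 4 * r) * D); last by rewrite /D; field.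
  by rewrite /X /D; ring: hR hS hU.
Qed.

Lemma square_eqns_exist R S U a b :
  R ^+ 2 = r ^+ 2 - 4 -> S ^+ 2 = s ^+ 2 - 4 -> U ^+ 2 = u ^+ 2 - 4 ->
  (a ^+ 2, b ^+ 2) = normal_squares r s u R S U ->
  exists l0 l1 l2, square_eqns r s u a b l0 l1 l2.
Proof.
move=> hR hS hU.
pose t := (U * s + u * S + 2 * R) / (U * S + u * s - 2 * r).
have [-> ht] := normal_squares_param hR hS hU (erefl t); case=> ha hb.
(* If [t ^+ 2 = 1], the quadratic equation for [t] factors as [(U - t * u) * (S - t * s) = 0], so
   [U ^+ 2 = u ^+ 2] or [S ^+ 2 = s ^+ 2], against [hU] or [hS]. *)
have t1 : t ^+ 2 - 1 != 0.
  apply/eqP => t1; have {}t1 : t ^+ 2 = 1 by apply/eqP; rewrite -subr_eq0 t1.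
  have : 2 * ((U - t * u) * (S - t * s))
      = (t ^+ 2 * (U * S + u * s - 2 * r)
         - (2 * t * (U * s + u * S) - (U * S + u * s + 2 * r)))
        - (t ^+ 2 - 1) * (U * S - u * s - 2 * r) by ring.
  rewrite ht t1 !subrr mul0r subrr.
  move/eqP; rewrite !mulf_eq0 pnatr_eq0 !subr_eq0 /=.
  case/orP=> /eqP h; [move: hU | move: hS]; rewrite h exprMn t1 mul1r;
    move/eqP; rewrite -subr_eq0 opprB addrC subrK pnatr_eq0 //.
(* This is the ratio [l0 / U = l2 / S], the reciprocal of the [k] used to describe [t] above. *)
pose k := sqrtC ((t ^+ 2 - 1) / 4).
have hk : k ^+ 2 = (t ^+ 2 - 1) / 4 by rewrite sqrtCK.
have k0 : k != 0 by rewrite -sqrf_eq0 hk mulf_neq0 // invr_eq0 pnatr_eq0.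
have a4 : a ^+ 4 = ((t * U - u) / 2) ^+ 2 by rewrite -ha -exprM.
have b4 : b ^+ 4 = ((t * S - s) / 2) ^+ 2 by rewrite -hb -exprM.
exists (U * k), (a * b * t / k), (S * k); split.
- rewrite a4 ha [(U * k) ^+ 2]exprMn hk.
  rewrite (_ : _ + _ + _ = (t ^+ 2 * U ^+ 2 - (u ^+ 2 - 4)) / 4); last by field.
  by rewrite -hU; field.
- have -> : 4 * a ^+ 3 * b + 2 * u * a * b = 2 * a * b * (2 * a ^+ 2 + u) by ring.
  by rewrite ha; field.
- rewrite (_ : _ + 2 * _ = a ^+ 2 * b ^+ 2 * t ^+ 2 / k ^+ 2 + 2 * (U * S) * k ^+ 2);
    last by field.
  rewrite hk ha hb; apply/eqP; rewrite -subr_eq0; apply/eqP.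
  (* The middle coefficient equation is the quadratic equation for [t], divided by
     [2 * (t ^+ 2 - 1)]. *)
  transitivity ((2 * t * (U * s + u * S) - (U * S + u * s + 2 * r)
    - t ^+ 2 * (U * S + u * s - 2 * r)) / (2 * (t ^+ 2 - 1))); first by field.
  by rewrite ht subrr mul0r.
- have -> : 4 * a * b ^+ 3 + 2 * s * a * b = 2 * a * b * (2 * b ^+ 2 + s) by ring.
  by rewrite hb; field.
- rewrite b4 hb [(S * k) ^+ 2]exprMn hk.
  rewrite (_ : _ + _ + _ = (t ^+ 2 * S ^+ 2 - (s ^+ 2 - 4)) / 4); last by field.
  by rewrite -hS; field.
Qed.

(** The outer and odd coefficients determine [U], [S] and [t] from [l0], [l1], [l2]; the middle one
    becomes the quadratic equation for [t], whose solution brings in [R]. *)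
Lemma square_eqns_normal_squares (R a b l0 l1 l2 : K) :
  R ^+ 2 = r ^+ 2 - 4 -> a != 0 -> b != 0 ->
  square_eqns r s u a b l0 l1 l2 ->
  exists S U, [/\ S ^+ 2 = s ^+ 2 - 4, U ^+ 2 = u ^+ 2 - 4 &
    (a ^+ 2, b ^+ 2) = normal_squares r s u R S U].
Proof.
move=> hR a0 b0 [h0 h1 h2 h3 h4].
pose p := a ^+ 2; pose q := b ^+ 2; pose v := l1 / (a * b).
have l1E : l1 = a * b * v by rewrite /v; field; apply/andP.
have e1 : l0 * v = 2 * p + u.
  rewrite /v mulrA; apply: (canLR (mulfK _)); first by rewrite mulf_neq0.
  apply: (mulfI (_ : 2 != 0 :> K)); first by rewrite pnatr_eq0.
  by rewrite -h1 /p; ring.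
have e2 : l2 * v = 2 * q + s.
  rewrite /v mulrA; apply: (canLR (mulfK _)); first by rewrite mulf_neq0.
  apply: (mulfI (_ : 2 != 0 :> K)); first by rewrite pnatr_eq0.
  by rewrite (mulrC l2) -h3 /q; ring.
have f0 : l0 ^+ 2 = 1 + u * p + p ^+ 2 by rewrite -h0 /p; ring.
have f2 : l2 ^+ 2 = 1 + s * q + q ^+ 2 by rewrite -h4 /q; ring.
(* Eliminating [p] between [e1] and [f0] leaves only constants, since [(2 * p + u) ^+ 2 - 4 * (1 + u
   * p + p ^+ 2) = u ^+ 2 - 4]. *)
have g0 : l0 ^+ 2 * (v ^+ 2 - 4) = u ^+ 2 - 4.
  by rewrite mulrBr -exprMn e1 f0; ring.
have g2 : l2 ^+ 2 * (v ^+ 2 - 4) = s ^+ 2 - 4.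
  by rewrite mulrBr -exprMn e2 f2; ring.
pose k := sqrtC (v ^+ 2 - 4).
have hk : k ^+ 2 = v ^+ 2 - 4 by rewrite sqrtCK.
have k0 : k != 0.
  by rewrite -sqrf_eq0 hk; apply: contraNneq hu => z; rewrite -g0 z mulr0.
pose U := l0 * k; pose S := l2 * k; pose t := v / k.
have hU : U ^+ 2 = u ^+ 2 - 4 by rewrite exprMn hk.
have hS : S ^+ 2 = s ^+ 2 - 4 by rewrite exprMn hk.
have pE : p = (t * U - u) / 2.
  have -> : t * U = 2 * p + u by rewrite -e1 /t /U; field.
  by field.
have qE : q = (t * S - s) / 2.
  have -> : t * S = 2 * q + s by rewrite -e2 /t /S; field.
  by field.
have D0 := normal_squares_denom_neq0 hS hU hdet.
have h2' : 6 * p * q + r + s * p + u * q = p * q * v ^+ 2 + 2 * (U * S) / k ^+ 2.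
  by rewrite /p /q h2 l1E /U /S; field.
have t1 : t ^+ 2 - 1 = 4 / k ^+ 2.
  have -> : t ^+ 2 - 1 = (v ^+ 2 - k ^+ 2) / k ^+ 2 by rewrite /t; field.
  by rewrite hk; congr (_ / _); ring.
have t10 : t ^+ 2 - 1 != 0.
  by rewrite t1 mulf_neq0 ?invr_eq0 ?sqrf_eq0 // pnatr_eq0.
have kE : k ^+ 2 = 4 / (t ^+ 2 - 1) by rewrite t1; field.
have vE : v ^+ 2 = t ^+ 2 * (4 / (t ^+ 2 - 1)) by rewrite -kE /t; field.
(* Completing the square in the quadratic equation for [t]: modulo [hS] and [hU], a quarter of the
   discriminant is [4 * (r ^+ 2 - 4)]. *)
have ht : (t * (U * S + u * s - 2 * r) - (U * s + u * S)) ^+ 2 = (2 * R) ^+ 2.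
  apply/eqP; rewrite -subr_eq0; apply/eqP.
  rewrite vE kE pE qE in h2'.
  have {}h2' : 2 * t * (U * s + u * S) - (U * S + u * s + 2 * r)
      - t ^+ 2 * (U * S + u * s - 2 * r) = 0.
    move/eqP: h2'; rewrite -subr_eq0 => /eqP h2'.
    rewrite -[RHS](mulr0 (2 * (t ^+ 2 - 1))) -{}h2'; field.
    by rewrite t10.
  have {}h2' : t ^+ 2 * (U * S + u * s - 2 * r) =
      2 * t * (U * s + u * S) - (U * S + u * s + 2 * r).
    by apply/esym/eqP; rewrite -subr_eq0; apply/eqP.
  transitivity ((U * S + u * s - 2 * r) * (t ^+ 2 * (U * S + u * s - 2 * r))
    - 2 * t * (U * S + u * s - 2 * r) * (U * s + u * S) + (U * s + u * S) ^+ 2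
    - (2 * R) ^+ 2); first by ring.
  by rewrite h2'; ring: hU hS hR.
(* The pair (S, U) is only determined up to a common sign, which changes the
   sign of t; this makes up for the choice of the square root R. *)
have solve (e : K) : e ^+ 2 = 1 ->
    t * (U * S + u * s - 2 * r) - (U * s + u * S) = e * (2 * R) ->
    (p, q) = normal_squares r s u R (e * S) (e * U).
  move=> he hte.
  have hS' : (e * S) ^+ 2 = s ^+ 2 - 4 by rewrite exprMn he mul1r.
  have hU' : (e * U) ^+ 2 = u ^+ 2 - 4 by rewrite exprMn he mul1r.
  have DE : e * U * (e * S) + u * s - 2 * r = U * S + u * s - 2 * r by ring: he.
  have te : e * t = (e * U * s + u * (e * S) + 2 * R)
                    / (e * U * (e * S) + u * s - 2 * r).
    apply: (mulIf D0); rewrite DE divfK //.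
    have {}hte : t * (U * S + u * s - 2 * r) = (U * s + u * S) + e * (2 * R).
      by rewrite -hte; ring.
    rewrite -(mulrA e t) hte.
    by ring: he.
  have [-> _] := normal_squares_param hR hS' hU' te.
  by rewrite pE qE; congr (_ / _ , _ / _); ring: he.
case: (sqr_eq ht (erefl _)) => h.
  exists S, U; split=> //.
  by have := solve 1; rewrite !mul1r; apply=> //; rewrite expr1n.
exists (- S), (- U); rewrite !sqrrN; split=> //.
by have := solve (-1); rewrite !mulN1r; apply=> //; rewrite sqrrN expr1n.
Qed.

(** Equal values mean [t * U = t' * U'] and [t * S = t' * S'], so [(S', U')] is [(S, U)] up to a
    common sign. With [R] fixed and nonzero, the sign change is impossible. *)
Lemma normal_squares_inj R S U S' U' :
  R ^+ 2 = r ^+ 2 - 4 -> S ^+ 2 = s ^+ 2 - 4 -> U ^+ 2 = u ^+ 2 - 4 ->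
  S' ^+ 2 = s ^+ 2 - 4 -> U' ^+ 2 = u ^+ 2 - 4 ->
  normal_squares r s u R S U = normal_squares r s u R S' U' ->
  (S, U) = (S', U').
Proof.
move=> hR hS hU hS' hU'.
have D0 := normal_squares_denom_neq0 hS hU hdet.
have D0' := normal_squares_denom_neq0 hS' hU' hdet.
pose t := (U * s + u * S + 2 * R) / (U * S + u * s - 2 * r).
pose t' := (U' * s + u * S' + 2 * R) / (U' * S' + u * s - 2 * r).
have [-> ht] := normal_squares_param hR hS hU (erefl t).
have [-> ht'] := normal_squares_param hR hS' hU' (erefl t').
have half (x y z : K) : (x - z) / 2 = (y - z) / 2 -> x = y.
  by move/mulIf; rewrite invr_eq0 pnatr_eq0 => /(_ isT) /addIr.
case=> /half tU /half tS.
have n0 (x z : K) : x ^+ 2 = z -> z != 0 -> x != 0.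
  by move=> <-; rewrite sqrf_eq0.
have R0 := n0 _ _ hR hr; have S0 := n0 _ _ hS hs; have U0 := n0 _ _ hU hu.
have tD : t * (U * S + u * s - 2 * r) = U * s + u * S + 2 * R by rewrite divfK.
have tD' : t' * (U' * S' + u * s - 2 * r) = U' * s + u * S' + 2 * R by rewrite divfK.
(* A common sign change keeps the denominator and negates [t]; adding the two formulas for [t] then
   leaves [4 * R = 0]. *)
have opp : U' = - U -> S' = - S -> (S, U) = (S', U').
  move=> UE SE; rewrite UE SE in tU tD'.
  have tt : t' = - t by apply: (mulIf U0); rewrite mulNr tU mulrN opprK.
  suff : 4 * R = 0 by move/eqP; rewrite mulf_eq0 pnatr_eq0 (negPf R0).
  transitivity ((t + t') * (U * S + u * s - 2 * r)); last by rewrite tt subrr mul0r.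
  transitivity (t * (U * S + u * s - 2 * r) + t' * (- U * - S + u * s - 2 * r));
    last by ring.
  by rewrite tD tD'; ring.
have same : U * S = U' * S' -> (S, U) = (S', U').
  move=> US; case: (sqr_eq hU' hU) => UE.
    by move: US; rewrite UE => /(mulfI U0) ->.
  apply: opp => //; apply: (mulfI U0); rewrite mulrN US UE mulNr opprK //.
(* For [t = 0] the products [t * U] and [t * S] carry no information; the constant term of the
   quadratic equation gives [U * S = U' * S'] instead. *)
have [t0 | t0] := eqVneq t 0.
  have t'0 : t' = 0.
    move: tU; rewrite t0 mul0r => /esym/eqP; rewrite mulf_eq0.
    by rewrite (negPf (n0 _ _ hU' hu)) orbF => /eqP.
  apply: same; rewrite t0 in ht; rewrite t'0 in ht'.
  move/eqP: ht; move/eqP: ht'; rewrite !expr0n !(mulr0, mul0r) /= !sub0r.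
  rewrite ![0 == _]eq_sym !oppr_eq0 => /eqP e' /eqP e.
  by apply: (addIr (u * s + 2 * r)); rewrite !addrA e e'.
have USc : U * S' = U' * S.
  have t'0 : t' != 0.
    by apply: contraNneq t0 => z; move: tU; rewrite z mul0r => /eqP;
       rewrite mulf_eq0 (negPf U0) orbF.
  apply: (mulfI t0); apply: (mulfI t'0).
  transitivity ((t * U) * (t' * S')); first by ring.
  by rewrite -tS tU; ring.
case: (sqr_eq hU' hU) => UE.
  by move: USc; rewrite UE => /(mulfI U0) ->.
by apply: opp => //; apply: (mulfI U0); rewrite USc UE mulrN mulNr.
Qed.
(** Fixing [R] removes the common sign, so the four choices of [(S, U)] give four distinct pairs of
    squares, each with four pairs of roots. *)
Lemma square_eqns_pairs :
  exists abs : seq (K * K), [/\ uniq abs, size abs = 16%N &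
    forall a b, (a, b) \in abs <->
      [/\ a != 0, b != 0 & exists l0 l1 l2, square_eqns r s u a b l0 l1 l2]].
Proof.
pose R := sqrtC (r ^+ 2 - 4); pose S := sqrtC (s ^+ 2 - 4).
pose U := sqrtC (u ^+ 2 - 4).
have hR : R ^+ 2 = r ^+ 2 - 4 by rewrite sqrtCK.
have hS : S ^+ 2 = s ^+ 2 - 4 by rewrite sqrtCK.
have hU : U ^+ 2 = u ^+ 2 - 4 by rewrite sqrtCK.
have S0 : S != 0 by rewrite -sqrf_eq0 hS.
have U0 : U != 0 by rewrite -sqrf_eq0 hU.
have neqN (x : K) : x != 0 -> x != - x.
  by move=> x0; rewrite -subr_eq0 opprK -mulr2n mulrn_eq0.
pose xs := [:: (S, U); (S, - U); (- S, U); (- S, - U)].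
have xsP x : reflect (x.1 ^+ 2 = s ^+ 2 - 4 /\ x.2 ^+ 2 = u ^+ 2 - 4) (x \in xs).
  apply: (iffP idP) => [|[/sqr_eq/(_ hS) h1 /sqr_eq/(_ hU) h2]].
    by rewrite !inE => /or4P[] /eqP -> /=; rewrite ?sqrrN.
  by case: x h1 h2 => x y /= [] -> [] ->; rewrite !inE eqxx ?orbT.
pose ns (x : K * K) := normal_squares r s u R x.1 x.2.
have uniq_ns : uniq (map ns xs).
  rewrite map_inj_in_uniq.
    by rewrite /= !inE !xpair_eqE !eqxx (negPf (neqN _ S0)) (negPf (neqN _ U0)).
  move=> [S1 U1] [S2 U2] /xsP[/= h1 h2] /xsP[/= h3 h4].
  exact: normal_squares_inj.
have nz_ns w : w \in map ns xs -> (w.1 != 0) && (w.2 != 0).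
  case/mapP=> [[S1 U1] /xsP[/= h1 h2] ->].
  (* The numerators are the denominator with the roles of [r], [s], [u] permuted, and the
     determinant is symmetric in these. *)
  have nz := normal_squares_denom_neq0.
  rewrite /ns /normal_squares /= !mulf_neq0 ?invr_eq0 ?(nz _ r s u) //.
    apply: nz => //; rewrite (_ : _ - 4 = r ^+ 2 + s ^+ 2 + u ^+ 2 - r * s * u - 4) //.
    by ring.
  apply: nz => //; rewrite (_ : _ - 4 = r ^+ 2 + s ^+ 2 + u ^+ 2 - r * s * u - 4) //.
  by ring.
have [abs [uabs sabs memabs]] := pair_square_roots uniq_ns nz_ns.
exists abs; split; rewrite ?sabs // => a b; split=> [/memabs abP | [a0 b0 [l0 [l1 [l2 h]]]]].
  have := nz_ns _ abP; rewrite !sqrf_eq0 => /andP[a0 b0]; split=> //.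
  case/mapP: abP => [[S1 U1] /xsP[/= h1 h2]]; exact: square_eqns_exist.
have [S1 [U1 [h1 h2 e]]] := square_eqns_normal_squares hR a0 b0 h.
by apply/memabs/mapP; exists (S1, U1); first apply/xsP.
Qed.

End Generic.

(** * Expressibility by radicals *)

Lemma gen_subfield_mono (S T : algC -> Prop) x :
  (forall y, S y -> gen_subfield T y) -> gen_subfield S x -> gen_subfield T x.
Proof.
move=> ST; elim=> [y /ST | | y z _ hy _ hz | y z _ hy _ hz | y _ hy] //.
- exact: gen_one.
- exact: gen_sub.
- exact: gen_mul.
- exact: gen_inv.
Qed.

Lemma radical_tower_sub F0 F x : radical_tower F0 F -> F0 x -> F x.
Proof.
by elim=> // G t n _ IH _ _ /IH Gx; apply: gen_base; left.
Qed.

(** The radicals of the second tower are adjoined in order on top of the first. Two radical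
    expressions thus lie in a common field, as closure under sums and products requires. *)
Lemma radical_tower_join F0 F G :
  radical_tower F0 F -> radical_tower F0 G ->
  exists H, [/\ radical_tower F0 H, forall x, F x -> H x & forall x, G x -> H x].
Proof.
move=> hF; elim=> [|{}G t n _ [H [hH FH GH]] n0 Gt].
  by exists F; split=> // x; apply: radical_tower_sub.
exists (adjoin H t); split.
- by apply: tower_step hH n0 _; apply: GH.
- by move=> x /FH Hx; apply: gen_base; left.
- move=> x; apply: gen_subfield_mono => y [/GH Hy | ->]; apply: gen_base; auto.
Qed.

Section RadicalExpr.
Context {r s u : algC}.
Let rad := radical_expr r s u.

(** This makes the top of a tower closed under the field operations, whether it is the base or an
    adjunction. *)
Lemma radical_tower_gen F :
  radical_tower (gen_subfield (fun y => y \in [:: r; s; u])) F ->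
  exists S, F = gen_subfield S.
Proof. by case=> [|G t n _ _ _]; eexists. Qed.

Lemma radical_expr_gen x : x \in [:: r; s; u] -> rad x.
Proof. by eexists; [apply: tower_base | apply: gen_base]. Qed.

Lemma radical_expr1 : rad 1.
Proof. by eexists; [apply: tower_base | apply: gen_one]. Qed.

Lemma radical_exprB x y : rad x -> rad y -> rad (x - y).
Proof.
move=> [F hF Fx] [G hG Gy]; have [H [hH FH GH]] := radical_tower_join hF hG.
exists H => //; have [S eH] := radical_tower_gen hH; subst H.
by apply: gen_sub; auto.
Qed.

Lemma radical_exprM x y : rad x -> rad y -> rad (x * y).
Proof.
move=> [F hF Fx] [G hG Gy]; have [H [hH FH GH]] := radical_tower_join hF hG.
exists H => //; have [S eH] := radical_tower_gen hH; subst H.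
by apply: gen_mul; auto.
Qed.

Lemma radical_exprV x : rad x -> rad x^-1.
Proof.
move=> [F hF Fx]; exists F => //; have [S eF] := radical_tower_gen hF; subst F.
exact: gen_inv.
Qed.

Lemma radical_expr_root n x : (0 < n)%N -> rad (x ^+ n) -> rad x.
Proof.
move=> n0 [F hF Fx]; exists (adjoin F x); first exact: tower_step hF n0 Fx.
by apply: gen_base; right.
Qed.

Lemma radical_expr0 : rad 0.
Proof. by rewrite -(subrr 1); apply: radical_exprB; apply: radical_expr1. Qed.

Lemma radical_exprN x : rad x -> rad (- x).
Proof. by rewrite -sub0r; apply: radical_exprB radical_expr0. Qed.

Lemma radical_exprD x y : rad x -> rad y -> rad (x + y).
Proof. by move=> hx hy; rewrite -[y]opprK; apply/radical_exprB/radical_exprN. Qed.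

Lemma radical_expr_nat n : rad n%:R.
Proof.
elim: n => [|n IH]; first exact: radical_expr0.
by rewrite -natr1; apply: radical_exprD IH radical_expr1.
Qed.

Lemma radical_exprX n x : rad x -> rad (x ^+ n).
Proof.
move=> hx; elim: n => [|n IH]; first exact: radical_expr1.
by rewrite exprS; apply: radical_exprM.
Qed.

End RadicalExpr.

Ltac radical_closed :=
  repeat first [assumption | apply: radical_exprD | apply: radical_exprB
    | apply: radical_exprN | apply: radical_exprM | apply: radical_exprV
    | apply: radical_exprX | apply: radical_expr_nat | apply: radical_expr1].

(** Two nested square roots: [2 * A * m ^+ 2 + B] squares to the discriminant, and it determines
    [m ^+ 2]. *)
Lemma radical_expr_even_quartic (r s u A B D m : algC) :
  radical_expr r s u A -> radical_expr r s u B -> radical_expr r s u D ->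
  A != 0 -> A * m ^+ 4 + B * m ^+ 2 + D = 0 -> radical_expr r s u m.
Proof.
move=> hA hB hD A0 hm; apply: (@radical_expr_root _ _ _ 2) => //.
have hc : radical_expr r s u (2 * A * m ^+ 2 + B).
  apply: (@radical_expr_root _ _ _ 2) => //.
  have -> : (2 * A * m ^+ 2 + B) ^+ 2
      = 4 * A * (A * m ^+ 4 + B * m ^+ 2 + D) + (B ^+ 2 - 4 * A * D) by ring.
  by rewrite hm mulr0 add0r; radical_closed.
have -> : m ^+ 2 = (2 * A * m ^+ 2 + B - B) / (2 * A) by field.
by radical_closed.
Qed.

(** The squares of [a] and [b] are rational in [r], [s], [u] and the square roots [R], [S], [U]; one
    further square root gives each of [a] and [b]. *)
Lemma radical_expr_square_eqns (r s u a b l0 l1 l2 : algC) :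
  u ^+ 2 - 4 != 0 -> r ^+ 2 + s ^+ 2 + u ^+ 2 - r * s * u - 4 != 0 ->
  a != 0 -> b != 0 -> square_eqns r s u a b l0 l1 l2 ->
  radical_expr r s u a /\ radical_expr r s u b.
Proof.
move=> hu hdet a0 b0 h.
have hr' : radical_expr r s u r by apply: radical_expr_gen; rewrite mem_head.
have hs' : radical_expr r s u s by apply: radical_expr_gen; rewrite !inE eqxx orbT.
have hu' : radical_expr r s u u by apply: radical_expr_gen; rewrite !inE eqxx !orbT.
have sq (x y : algC) : radical_expr r s u y -> x ^+ 2 = y ^+ 2 - 4 ->
    radical_expr r s u x.
  move=> hy e; apply: (@radical_expr_root _ _ _ 2) => //; rewrite e.
  by radical_closed.
pose R := sqrtC (r ^+ 2 - 4).
have hR : R ^+ 2 = r ^+ 2 - 4 by rewrite sqrtCK.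
have [S [U [hS hU [ha hb]]]] := square_eqns_normal_squares hu hdet hR a0 b0 h.
have {}hR := sq _ _ hr' hR; have {}hS := sq _ _ hs' hS; have {}hU := sq _ _ hu' hU.
by split; apply: (@radical_expr_root _ _ _ 2) => //; rewrite ?ha ?hb; radical_closed.
Qed.

(** * Lines of the projective plane *)

Definition line (a b c : algC) : {vspace 'rV[algC]_3} :=
  lker (linfun (mulmxr (\col_(i < 3) [:: a; b; c]`_i) : 'rV[algC]_3 -> 'rV[algC]_1)).

Lemma sum_ord3 (F : 'I_3 -> algC) : \sum_i F i = F 0 + F 1 + F 2.
Proof.
rewrite !big_ord_recl big_ord0 addr0 addrA.
by congr (_ + F _ + F _); apply: val_inj.
Qed.

Lemma lineP a b c : line_eqn (line a b c) a b c.
Proof.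
move=> p; rewrite memv_ker lfunE /= !(mulrC _ (p 0 _)); split=> [/eqP/rowP/(_ 0)|h].
  by rewrite !mxE sum_ord3 !mxE.
by apply/eqP/rowP => i; rewrite ord1 !mxE sum_ord3 !mxE.
Qed.

Lemma line_eqn_inj L M a b c : line_eqn L a b c -> line_eqn M a b c -> L = M.
Proof.
move=> hL hM; apply/vspaceP => p; apply/idP/idP; first by move/hL/hM.
by move/hM/hL.
Qed.

(** Rank-nullity: the linear form has values in a one-dimensional space and is nonzero on some unit
    vector. *)
Lemma dim_line a b c : (a, b, c) != (0, 0, 0) -> \dim (line a b c) = 2%N.
Proof.
move=> nz; set n := \col_(i < 3) [:: a; b; c]`_i.
set f := linfun (mulmxr n : 'rV[algC]_3 -> 'rV[algC]_1).
suff e1 : \dim (limg f) = 1%N.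
  have := limg_ker_dim f fullv; rewrite capfv e1 dimvf dim_matrix addn1.
  by case.
apply/eqP; rewrite eqn_leq; apply/andP; split.
  by apply: leq_trans (dimvS (subvf _)) _; rewrite dimvf.
rewrite lt0n dimv_eq0; apply: contraNneq nz => z.
have fz i : [:: a; b; c]`_(i : 'I_3) = 0.
  have : f (delta_mx 0 i) \in limg f by apply: memv_img; apply: memvf.
  rewrite z memv0 lfunE /= -rowE => /eqP/rowP/(_ 0).
  by rewrite !mxE.
by rewrite (fz 0 : a = 0) (fz 1 : b = 0) (fz 2 : c = 0).
Qed.

Lemma line_exists (L : {vspace 'rV[algC]_3}) : \dim L = 2%N ->
  exists a b c, (a, b, c) != (0, 0, 0) /\ L = line a b c.
Proof.
(* The rows of [M] are a basis of [L]; having rank at most 2 in three columns, they have a common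
   nonzero normal [v]. *)
move=> dL; pose M := \matrix_(i < \dim L) (vbasis L)`_i.
have : kermx M^T != 0.
  rewrite -mxrank_eq0 mxrank_ker mxrank_tr subn_eq0 -ltnNge.
  by apply: leq_ltn_trans (rank_leq_row M) _; rewrite dL.
case/rowV0Pn=> v /sub_kermxP vM v0.
exists (v 0 0), (v 0 1), (v 0 2).
have nz : (v 0 0, v 0 1, v 0 2) != (0, 0, 0).
  apply: contraNneq v0 => -[e0 e1 e2]; apply/eqP/rowP=> i; rewrite mxE.
  case: i => -[|[|[|//]]] hi; [rewrite -e0 | rewrite -e1 | rewrite -e2];
    by congr (v _ _); apply: val_inj.
split=> //; apply/eqP; rewrite eqEdim dim_line // dL andbT.
rewrite -(span_basis (vbasisP L)); apply/span_subvP => p.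
case/(nthP 0) => i; rewrite size_tuple => hi <-; apply/lineP.
by move/rowP/(_ (Ordinal hi)): vM; rewrite !mxE sum_ord3 !mxE.
Qed.

Lemma line_scale k a b c : k != 0 -> line (k * a) (k * b) (k * c) = line a b c.
Proof.
move=> k0; apply: line_eqn_inj (@lineP a b c) => p.
have e : k * a * p 0 0 + k * b * p 0 1 + k * c * p 0 2
    = k * (a * p 0 0 + b * p 0 1 + c * p 0 2) by ring.
split=> [/lineP/eqP | h]; first by rewrite e mulf_eq0 (negPf k0) => /eqP.
by apply/lineP; rewrite e h mulr0.
Qed.

(** The points (b, -a, 0), (c, 0, -a) and (0, c, -b) lie on the first line; on the second they say
    that the 2 by 2 minors of the two normals vanish. *)
Lemma line_inj a b c a' b' c' : line a b c = line a' b' c' ->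
  [/\ a * b' = a' * b, a * c' = a' * c & b * c' = b' * c].
Proof.
move=> e; have h x y z : a * x + b * y + c * z = 0 -> a' * x + b' * y + c' * z = 0.
  pose p : 'rV[algC]_3 := \row_i [:: x; y; z]`_i => h.
  have : p \in line a b c by apply/lineP; rewrite !mxE.
  by rewrite e => /lineP; rewrite !mxE.
have z1 : a * b + b * (- a) + c * 0 = 0 by ring.
have z2 : a * c + b * 0 + c * (- a) = 0 by ring.
have z3 : a * 0 + b * c + c * (- b) = 0 by ring.
move: {z1 z2 z3} (h _ _ _ z1) (h _ _ _ z2) (h _ _ _ z3).
rewrite !mulr0 !mulrN !addr0 add0r => /subr0_eq h1 /subr0_eq h2 /subr0_eq h3.
by split; rewrite ?h1 ?h2 ?h3 // mulrC.
Qed.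

(** * Bitangents of the quartic *)

(** A monomial of degree 2 is a product of two variables, and each variable restricts to a linear
    form in [x] and [y]. *)
Lemma quadratic_form_restrict (n : nat) (R : comNzRingType) (q : {mpoly R[n]})
    (e e' : 'I_n -> R) : q \is 2.-homog ->
  exists l0 l1 l2, forall x y, q.@[fun k => x * e k + y * e' k]
    = l0 * x ^+ 2 + l1 * (x * y) + l2 * y ^+ 2.
Proof.
move/dhomogP=> hq; have {hq} : {in msupp q, forall m, mdeg m = 2%N} := hq.
(* The support is generalized to any list of monomials of degree 2, with the coefficients of [q]
   kept, to allow induction. *)
suff sum_restrict (ms : seq 'X_{1..n}) : {in ms, forall m, mdeg m = 2%N} ->
    exists l0 l1 l2, forall x y,
      (\sum_(m <- ms) q@_m *: 'X_[m]).@[fun k => x * e k + y * e' k]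
        = l0 * x ^+ 2 + l1 * (x * y) + l2 * y ^+ 2.
  by move=> /sum_restrict[l0 [l1 [l2 h]]]; exists l0, l1, l2 => x y; rewrite -h -mpolyE.
elim: ms => [|m ms IH] hms.
  by exists 0, 0, 0 => x y; rewrite big_nil meval0 !mul0r !addr0.
have [|l0 [l1 [l2 h]]] := IH; first by move=> m' hm'; apply: hms; rewrite inE hm' orbT.
have [i [j ->]] : exists i j, m = (U_(i) + U_(j))%MM.
  have dm : mdeg m = 2%N by apply: hms; rewrite mem_head.
  have /existsP[i mi] : [exists i, m i != 0%N].
    rewrite -negb_forall; apply/forallP => z; move: dm; rewrite mdegE big1 // => i _.
    exact/eqP.
  rewrite -lep1mP in mi; move: dm; rewrite -(submK mi) mdegD mdeg1 addn1 => -[].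
  by move/eqP/mdeg1P=> [j /eqP ->]; exists j, i.
pose c := q@_(U_(i) + U_(j))%MM.
exists (c * (e i * e j) + l0), (c * (e i * e' j + e' i * e j) + l1),
  (c * (e' i * e' j) + l2) => x y.
by rewrite big_cons mevalD h mevalZ mpolyXD mevalM !mevalXU -/c; ring.
Qed.

(** The coordinates [i] and [j] parametrize [L], so a binary form on [L] lifts to the ternary form
    with the same coefficients in ['X_i] and ['X_j]. *)
Lemma bitangent_param f (L : {vspace 'rV[algC]_3}) (i j : 'I_3) (e e' : 'rV[algC]_3) : 
    \dim L = 2%N ->
  (forall p : 'rV[algC]_3, p \in L <-> p = p 0 i *: e + p 0 j *: e') ->
  [/\ e 0 i = 1, e 0 j = 0, e' 0 i = 0 & e' 0 j = 1] ->
  bitangent f L <-> exists l0 l1 l2, forall x y,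
    f.@[(x *: e + y *: e') 0] = (l0 * x ^+ 2 + l1 * (x * y) + l2 * y ^+ 2) ^+ 2.
Proof.
move=> dL hL [ei ej e'i e'j].
have inL x y : x *: e + y *: e' \in L.
  by apply/hL; rewrite !mxE ei ej e'i e'j !(mulr0, mulr1, addr0, add0r).
split=> [[_ [q hq fq]] | [l0 [l1 [l2 h]]]].
  have [l0 [l1 [l2 hl]]] := quadratic_form_restrict (e 0) (e' 0) hq.
  exists l0, l1, l2 => x y; rewrite fq // -hl; congr (_ ^+ 2).
  by apply: meval_eq => k; rewrite !mxE.
split=> //; exists (l0 *: 'X_i ^+ 2 + l1 *: ('X_i * 'X_j) + l2 *: 'X_j ^+ 2).
  have hX k k' : ('X_k * 'X_k' : {mpoly algC[3]}) \is 2.-homog.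
    by apply: (@dhomogM _ _ _ 1 _ 1); rewrite dhomogX /= mdeg1.
  by rewrite !expr2 !(rpredD, rpredZ).
move=> p pL; rewrite {1}(iffLR (hL p) pL) h.
by rewrite !(mevalD, mevalZ, mevalM, rmorphXn, mevalXU).
Qed.

(** * Partial derivatives of the quartic and consequences of smoothness *)

Lemma meval_quartic r s u v : (quartic r s u).@[v] =
  v 0 ^+ 4 + v 1 ^+ 4 + v 2 ^+ 4 + r * (v 0 ^+ 2 * v 1 ^+ 2)
    + s * (v 1 ^+ 2 * v 2 ^+ 2) + u * (v 2 ^+ 2 * v 0 ^+ 2).
Proof.
by rewrite /quartic !(mevalD, mevalZ, mevalM, rmorphXn, mevalXU).
Qed.

Lemma mderiv_quartic r s u v :
  let x := v 0 in let y := v 1 in let z := v 2 in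
  [/\ ((quartic r s u)^`M(0)).@[v] = 2 * x * (2 * x ^+ 2 + r * y ^+ 2 + u * z ^+ 2),
      ((quartic r s u)^`M(1)).@[v] = 2 * y * (r * x ^+ 2 + 2 * y ^+ 2 + s * z ^+ 2) &
      ((quartic r s u)^`M(2)).@[v] = 2 * z * (u * x ^+ 2 + s * y ^+ 2 + 2 * z ^+ 2)].
Proof.
rewrite /quartic !exprS !expr0.
have dX (i j : 'I_3) : ('X_i : {mpoly algC[3]})^`M(j) = (i == j)%:R.
  rewrite mderivX mnm1E; case: eqP => [->|_]; last by rewrite scale0r.
  by rewrite (_ : (_ - _)%MM = 0%MM) ?mpolyX0 ?scale1r //; apply/mnmP=> k; rewrite !mnmE subnn.
by split; rewrite !(mderivD, mderivZ, mderivM, mderivC, dX)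
  !(mevalD, mevalZ, mevalM, mevalXU, meval1, meval0, mevalC) /=; ring.
Qed.

(** Square roots of [A], [B], [C] are coordinates of a point where all partial derivatives of the
    quartic vanish; smoothness leaves only the zero vector. *)
Lemma smooth_quartic_conic (r s u A B C : algC) :
  smooth_curve (quartic r s u) ->
  A * (2 * A + r * B + u * C) = 0 -> B * (r * A + 2 * B + s * C) = 0 ->
  C * (u * A + s * B + 2 * C) = 0 -> [/\ A = 0, B = 0 & C = 0].
Proof.
move=> sm hA hB hC.
rewrite -[A]sqrtCK -[B]sqrtCK -[C]sqrtCK in hA hB hC *.
move: (sqrtC A) (sqrtC B) (sqrtC C) hA hB hC => x y z hA hB hC.
pose p : 'rV[algC]_3 := \row_i [:: x; y; z]`_i.
have [p0 | pn0] := eqVneq p 0.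
  have pz i : [:: x; y; z]`_(i : 'I_3) = 0.
    by have /rowP/(_ i) := p0; rewrite !mxE.
  by rewrite (pz 0 : x = 0) (pz 1 : y = 0) (pz 2 : z = 0) expr0n.
have fp : (quartic r s u).@[p 0] = 0.
  rewrite meval_quartic !mxE /=.
  (* Euler's relation places the point on the curve. *)
  transitivity ((x ^+ 2 * (2 * x ^+ 2 + r * y ^+ 2 + u * z ^+ 2)
    + y ^+ 2 * (r * x ^+ 2 + 2 * y ^+ 2 + s * z ^+ 2)
    + z ^+ 2 * (u * x ^+ 2 + s * y ^+ 2 + 2 * z ^+ 2)) / 2); first by field.
  by rewrite hA hB hC !addr0 mul0r.
have kill (v k : algC) : v ^+ 2 * k = 0 -> 2 * v * k = 0.
  move=> /eqP; rewrite mulf_eq0 sqrf_eq0 => /orP[] /eqP ->; last by rewrite mulr0.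
  by rewrite mulr0 mul0r.
have [] := mderiv_quartic r s u (p 0); rewrite !mxE /= => d0 d1 d2.
rewrite {}(kill _ _ hA) in d0; rewrite {}(kill _ _ hB) in d1.
rewrite {}(kill _ _ hC) in d2.
have [[[|[|[|//]]] hi]] := sm p pn0 fp.
- by rewrite (_ : Ordinal hi = 0) ?d0 ?eqxx //; apply: val_inj.
- by rewrite (_ : Ordinal hi = 1) ?d1 ?eqxx //; apply: val_inj.
- by rewrite (_ : Ordinal hi = 2) ?d2 ?eqxx //; apply: val_inj.
Qed.

Lemma smooth_quartic_coefs (r s u : algC) : smooth_curve (quartic r s u) ->
  [/\ r ^+ 2 - 4 != 0, s ^+ 2 - 4 != 0, u ^+ 2 - 4 != 0 &
      r ^+ 2 + s ^+ 2 + u ^+ 2 - r * s * u - 4 != 0].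
Proof.
move=> sm; have two0 : (-2 : algC) != 0 by rewrite oppr_eq0 pnatr_eq0.
(* If [s ^+ 2 = 4], the conic restricts to a square on the line [A = 0], with double point (0, s,
   -2). This case comes first because [s ^+ 2 - 4] is the nonzero coordinate used in the determinant
   case. *)
have hs : s ^+ 2 - 4 != 0.
  apply/eqP => /subr0_eq hs.
  have [] := @smooth_quartic_conic r s u 0 s (-2) sm; try by ring: hs.
  by move=> _ _ /eqP; rewrite (negPf two0).
split=> //.
- apply/eqP => /subr0_eq hr.
  have [] := @smooth_quartic_conic r s u r (-2) 0 sm; try by ring: hr.
  by move=> _ /eqP; rewrite (negPf two0).
- apply/eqP => /subr0_eq hu.
  have [] := @smooth_quartic_conic r s u (-2) 0 u sm; try by ring: hu.
  by move=> /eqP; rewrite (negPf two0).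
(* If the determinant of the conic vanishes, the first column of its adjugate
   is a singular point. *)
- apply/eqP => hd.
  have [] := @smooth_quartic_conic r s u (s ^+ 2 - 4) (2 * r - u * s) (2 * u - r * s) sm.
  + rewrite (_ : _ + _ + _ = 2 * (r ^+ 2 + s ^+ 2 + u ^+ 2 - r * s * u - 4)); last by ring.
    by rewrite hd !mulr0.
  + by ring.
  + by ring.
  by move/eqP; rewrite (negPf hs).
Qed.

(** * Bitangency conditions for lines in normal form *)

Lemma bitangent_line_ab1 r s u a b : bitangent (quartic r s u) (line a b 1) <->
  exists l0 l1 l2, square_eqns r s u a b l0 l1 l2.
Proof.
pose e : 'rV[algC]_3 := \row_i [:: 1; 0; - a]`_i.
pose e' : 'rV[algC]_3 := \row_i [:: 0; 1; - b]`_i.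
have dL : \dim (line a b 1) = 2%N.
  by rewrite dim_line // xpair_eqE oner_eq0 andbF.
rewrite (@bitangent_param _ _ 0 1 e e' dL); first last.
- by rewrite !mxE.
- move=> p; split=> [/lineP h | ->].
    apply/rowP => -[[|[|[|//]]] hi]; rewrite !mxE /= ?mulr0 ?mulr1 ?addr0 ?add0r.
    + by congr (p _ _); apply: val_inj.
    + by congr (p _ _); apply: val_inj.
    + rewrite (_ : Ordinal hi = 2); last exact: val_inj.
      by apply/eqP; rewrite -subr_eq0 -h; apply/eqP; ring.
  by apply/lineP; rewrite !mxE /=; ring.
split=> -[l0 [l1 [l2 h]]]; exists l0, l1, l2.
  apply/binary_quartic_squareP => x y; rewrite -h meval_quartic !mxE /=.
  by ring.
move/binary_quartic_squareP: h => h x y; rewrite -h meval_quartic !mxE /=.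
by ring.
Qed.

(** On a line through the vertex (0, 1, 0) the quartic is biquadratic in [x] and [y] with [y ^+ 4]
    of coefficient 1; the condition is the vanishing of its discriminant. *)
Lemma bitangent_line_a01 r s u a : bitangent (quartic r s u) (line a 0 1) <->
  (s ^+ 2 - 4) * a ^+ 4 + (2 * (r * s) - 4 * u) * a ^+ 2 + (r ^+ 2 - 4) = 0.
Proof.
rewrite bitangent_line_ab1.
have -> : (exists l0 l1 l2, square_eqns r s u a 0 l0 l1 l2) <->
    (r + s * a ^+ 2) ^+ 2 = 4 * (1 + u * a ^+ 2 + a ^+ 4).
  rewrite -biquadratic_squareP; split=> -[l0 [l1 [l2 h]]]; exists l0, l1, l2.
    by move/binary_quartic_squareP: h => h x y; rewrite -h; ring.
  by apply/binary_quartic_squareP => x y; rewrite -h; ring.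
split=> [/eqP|] h; first by rewrite -subr_eq0 in h; rewrite -(eqP h); ring.
by apply/eqP; rewrite -subr_eq0 -h; apply/eqP; ring.
Qed.

Lemma bitangent_line_0b1 r s u b : bitangent (quartic r s u) (line 0 b 1) <->
  (u ^+ 2 - 4) * b ^+ 4 + (2 * (r * u) - 4 * s) * b ^+ 2 + (r ^+ 2 - 4) = 0.
Proof.
rewrite bitangent_line_ab1.
have -> : (exists l0 l1 l2, square_eqns r s u 0 b l0 l1 l2) <->
    (r + u * b ^+ 2) ^+ 2 = 4 * (1 + s * b ^+ 2 + b ^+ 4).
  (* The line passes through (1, 0, 0), so the coefficient 1 belongs to [x ^+ 4] and the variables
     are exchanged. *)
  rewrite -biquadratic_squareP; split=> -[l0 [l1 [l2 h]]]; exists l2, l1, l0.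
    move/binary_quartic_squareP: h => h x y.
    rewrite (_ : l2 * x ^+ 2 + _ + _ = l0 * y ^+ 2 + l1 * (y * x) + l2 * x ^+ 2).
      by rewrite -h; ring.
    by ring.
  apply/binary_quartic_squareP => x y.
  rewrite (_ : l2 * x ^+ 2 + _ + _ = l0 * y ^+ 2 + l1 * (y * x) + l2 * x ^+ 2).
    by rewrite -h; ring.
  by ring.
split=> [/eqP|] h; first by rewrite -subr_eq0 in h; rewrite -(eqP h); ring.
by apply/eqP; rewrite -subr_eq0 -h; apply/eqP; ring.
Qed.

Lemma bitangent_line_m10 r s u m : bitangent (quartic r s u) (line m 1 0) <->
  (s ^+ 2 - 4) * m ^+ 4 + (2 * (s * u) - 4 * r) * m ^+ 2 + (u ^+ 2 - 4) = 0.
Proof.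
pose e : 'rV[algC]_3 := \row_i [:: 1; - m; 0]`_i.
pose e' : 'rV[algC]_3 := \row_i [:: 0; 0; 1]`_i.
have dL : \dim (line m 1 0) = 2%N.
  by rewrite dim_line // !xpair_eqE oner_eq0 andbF.
rewrite (@bitangent_param _ _ 0 2 e e' dL); first last.
- by rewrite !mxE.
- move=> p; split=> [/lineP h | ->].
    apply/rowP => -[[|[|[|//]]] hi]; rewrite !mxE /= ?mulr0 ?mulr1 ?addr0 ?add0r.
    + by congr (p _ _); apply: val_inj.
    + rewrite (_ : Ordinal hi = 1); last exact: val_inj.
      by apply/eqP; rewrite -subr_eq0 -h; apply/eqP; ring.
    + by congr (p _ _); apply: val_inj.
  by apply/lineP; rewrite !mxE /=; ring.
transitivity ((u + s * m ^+ 2) ^+ 2 = 4 * (1 + r * m ^+ 2 + m ^+ 4)).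
  rewrite -biquadratic_squareP.
  split=> -[l0 [l1 [l2 h]]]; exists l0, l1, l2 => x y; rewrite -h;
    by rewrite meval_quartic !mxE /=; ring.
split=> [/eqP|] h; first by rewrite -subr_eq0 in h; rewrite -(eqP h); ring.
by apply/eqP; rewrite -subr_eq0 -h; apply/eqP; ring.
Qed.

(** This coordinate line lies outside the families above; the other two occur in them with parameter
    0. *)
Lemma bitangent_line_100 r s u :
  bitangent (quartic r s u) (line 1 0 0) -> s ^+ 2 - 4 = 0.
Proof.
pose e : 'rV[algC]_3 := \row_i [:: 0; 1; 0]`_i.
pose e' : 'rV[algC]_3 := \row_i [:: 0; 0; 1]`_i.
have dL : \dim (line 1 0 0) = 2%N.
  by rewrite dim_line // !xpair_eqE oner_eq0.
rewrite (@bitangent_param _ _ 1 2 e e' dL); first last.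
- by rewrite !mxE.
- move=> p; split=> [/lineP h | ->].
    apply/rowP => -[[|[|[|//]]] hi]; rewrite !mxE /= ?mulr0 ?mulr1 ?addr0 ?add0r.
    + by rewrite (_ : Ordinal hi = 0) -?[RHS]h; [ring | apply: val_inj].
    + by congr (p _ _); apply: val_inj.
    + by congr (p _ _); apply: val_inj.
  by apply/lineP; rewrite !mxE /=; ring.
move=> [l0 [l1 [l2 h]]].
have /biquadratic_squareP -> : exists l0 l1 l2, forall x y : algC,
    1 * x ^+ 4 + s * (x ^+ 2 * y ^+ 2) + y ^+ 4
      = (l0 * x ^+ 2 + l1 * (x * y) + l2 * y ^+ 2) ^+ 2.
  exists l0, l1, l2 => x y; rewrite -h meval_quartic !mxE /=.
  by ring.
by rewrite mulr1 subrr.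
Qed.

(** * Enumeration of the 28 bitangents *)

(** The last nonzero coordinate is 1. The normal (1, 0, 0) is left out, as its line is never
    bitangent to a smooth quartic of the family. *)
Definition normalized (n : algC * algC * algC) : bool :=
  (n.2 == 1) || ((n.2 == 0) && (n.1.2 == 1)).

Definition line3 (n : algC * algC * algC) := line n.1.1 n.1.2 n.2.

Lemma line3_inj : {in normalized &, injective line3}.
Proof.
move=> [[a b] c] [[a' b'] c']; rewrite !unfold_in /normalized /line3 /= => hn hn' /line_inj[].
case/orP: hn => [/eqP -> | /andP[/eqP -> /eqP ->]];
  case/orP: hn' => [/eqP -> | /andP[/eqP -> /eqP ->]]; rewrite ?mulr1 ?mulr0.
- by move=> _ -> ->.
- by move=> _ _ /esym/eqP; rewrite oner_eq0.
- by move=> _ _ /eqP; rewrite oner_eq0.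
- by move=> -> _ _.
Qed.

Lemma line_normalize (L : {vspace 'rV[algC]_3}) : \dim L = 2%N ->
  L = line 1 0 0 \/ exists2 n, normalized n & L = line3 n.
Proof.
move=> /line_exists[a [b [c [nz ->]]]].
have [c0 | c0] := eqVneq c 0; last first.
  right; exists (a / c, b / c, 1); first by rewrite /normalized eqxx.
  rewrite -(@line_scale c^-1) ?invr_eq0 // mulVf //.
  by rewrite /line3 /= !(mulrC c^-1).
have [b0 | b0] := eqVneq b 0; last first.
  right; exists (a / b, 1, 0); first by rewrite /normalized !eqxx orbT.
  rewrite -(@line_scale b^-1) ?invr_eq0 // c0 mulr0 mulVf //.
  by rewrite /line3 /= mulrC.
left; rewrite c0 b0 in nz *.
have a0 : a != 0 by apply: contraNneq nz => ->.
by rewrite -(@line_scale a^-1) ?invr_eq0 // !mulr0 mulVf.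
Qed.

(** The list joins 16 normals with [a * b != 0] and three families of 4, told apart by which
    coordinates vanish. *)
Lemma bitangent_normals (r s u : algC) : smooth_curve (quartic r s u) ->
  exists ns : seq (algC * algC * algC),
    [/\ uniq ns, size ns = 28%N, {subset ns <= normalized},
        forall n, n \in ns ->
          [/\ radical_expr r s u n.1.1, radical_expr r s u n.1.2
             & radical_expr r s u n.2] &
        forall L, bitangent (quartic r s u) L <-> L \in map line3 ns].
Proof.
move=> /smooth_quartic_coefs[hr hs hu hd].
have rad_r : radical_expr r s u r by apply: radical_expr_gen; rewrite mem_head.
have rad_s : radical_expr r s u s by apply: radical_expr_gen; rewrite !inE eqxx orbT.
have rad_u : radical_expr r s u u by apply: radical_expr_gen; rewrite !inE eqxx !orbT.
have [abs [uab sab abP]] := square_eqns_pairs hu hs hr hd.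
(* The three even quartics share this discriminant, a multiple of the determinant of the conic. *)
have disc (B A D : algC) : B ^+ 2 - 4 * A * D
    = 16 * (r ^+ 2 + s ^+ 2 + u ^+ 2 - r * s * u - 4) -> B ^+ 2 - 4 * A * D != 0.
  by move=> ->; rewrite mulf_neq0 // pnatr_eq0.
have [|as_ [uas sas asP]] := @even_quartic_roots _ _ (2 * (r * s) - 4 * u) _ hs hr.
  by apply: disc; ring.
have [|bs [ubs sbs bsP]] := @even_quartic_roots _ _ (2 * (r * u) - 4 * s) _ hu hr.
  by apply: disc; ring.
have [|ms [ums sms msP]] := @even_quartic_roots _ _ (2 * (s * u) - 4 * r) _ hs hu.
  by apply: disc; ring.
(* This and [bs0] keep the line [z = 0] out of the families [ns2] and [ns3], which are therefore
   disjoint. *)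
have as0 : 0 \notin as_.
  by apply/negP => /asP; rewrite !expr0n !mulr0 !add0r => /eqP; rewrite (negPf hr).
have bs0 : 0 \notin bs.
  by apply/negP => /bsP; rewrite !expr0n !mulr0 !add0r => /eqP; rewrite (negPf hr).
pose ns1 := [seq (w, 1 : algC) | w <- abs]; pose ns2 := [seq (a, 0 : algC, 1 : algC) | a <- as_].
pose ns3 := [seq (0 : algC, b, 1 : algC) | b <- bs].
pose ns4 := [seq (m, 1 : algC, 0 : algC) | m <- ms].
have ns1P (a b c : algC) : (a, b, c) \in ns1 -> [/\ a != 0, b != 0, c = 1 & (a, b) \in abs].
  by case/mapP=> -[a' b'] h [-> -> ->]; have /abP[] := h.
have ns2P (a b c : algC) : (a, b, c) \in ns2 -> [/\ a != 0, b = 0, c = 1 & a \in as_].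
  by case/mapP=> a' h [-> -> ->]; split=> //; apply: contraNneq as0 => <-.
have ns3P (a b c : algC) : (a, b, c) \in ns3 -> [/\ a = 0, b != 0, c = 1 & b \in bs].
  by case/mapP=> b' h [-> -> ->]; split=> //; apply: contraNneq bs0 => <-.
have ns4P (a b c : algC) : (a, b, c) \in ns4 -> [/\ b = 1, c = 0 & a \in ms].
  by case/mapP=> m h [-> -> ->].
exists (ns1 ++ ns2 ++ ns3 ++ ns4); split.
- rewrite !cat_uniq !map_inj_uniq ?uab ?uas ?ubs ?ums //=;
    try by [move=> ? ? [] | move=> [? ?] [? ?] [-> ->]].
  rewrite !andbT; apply/and3P; split; apply/hasPn => -[[a b] c];
    rewrite ?mem_cat; apply: contraL.
  + case/ns1P=> a0 b0 -> _; apply/negP => /or3P[/ns2P[_ /eqP] | /ns3P[/eqP] | /ns4P[_ /eqP]].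
    * by rewrite (negPf b0).
    * by rewrite (negPf a0).
    * by rewrite oner_eq0.
  + case/ns2P=> a0 _ -> _; apply/negP => /orP[/ns3P[/eqP] | /ns4P[_ /eqP]].
    * by rewrite (negPf a0).
    * by rewrite oner_eq0.
  + case/ns3P=> _ _ -> _; apply/negP => /ns4P [_ /eqP].
    by rewrite oner_eq0.
- by rewrite !size_cat !size_map sab sas sbs sms.
- move=> [[a b] c]; rewrite !mem_cat.
  by case/or4P=> [/ns1P[_ _ -> _] | /ns2P[_ _ -> _] | /ns3P[_ _ -> _] | /ns4P[-> -> _]];
    rewrite unfold_in /normalized /= !eqxx ?orbT.
- move=> [[a b] c]; rewrite !mem_cat /=.
  have rad0 := @radical_expr0 r s u; have rad1 := @radical_expr1 r s u.
  case/or4P=> [/ns1P[a0 b0 -> abn] | /ns2P[_ -> -> /asP h] | /ns3P[-> _ -> /bsP h]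
      | /ns4P[-> -> /msP h]].
  + have [_ _ [l0 [l1 [l2 h]]]] := iffLR (abP a b) abn.
    by have [] := radical_expr_square_eqns hu hd a0 b0 h.
  + by split=> //; apply: radical_expr_even_quartic h => //; radical_closed.
  + by split=> //; apply: radical_expr_even_quartic h => //; radical_closed.
  + by split=> //; apply: radical_expr_even_quartic h => //; radical_closed.
- move=> L; split=> [bL | /mapP[[[a b] c]]]; last first.
    rewrite !mem_cat /line3 /= => /or4P[/ns1P | /ns2P | /ns3P | /ns4P] [].
    + by move=> _ _ -> /abP[_ _ h] ->; apply/bitangent_line_ab1.
    + by move=> _ -> -> /asP h ->; apply/bitangent_line_a01.
    + by move=> -> _ -> /bsP h ->; apply/bitangent_line_0b1.
    + by move=> -> -> /msP h ->; apply/bitangent_line_m10.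
  have [dL _] := bL; have [Lx | [[[a b] c] nn Ln]] := line_normalize dL.
    by move: bL; rewrite Lx => /bitangent_line_100/eqP; rewrite (negPf hs).
  rewrite Ln; apply: map_f; rewrite {}Ln /line3 /= in bL.
  rewrite !mem_cat; case/orP: nn => /= [/eqP c1 | /andP[/eqP c0 /eqP b1]]; subst.
    have [b0 | b0] := eqVneq b 0; first subst.
      by move/bitangent_line_a01/asP: bL => h; rewrite (map_f (fun a => (a, 0, 1)) h) !orbT.
    have [a0 | a0] := eqVneq a 0; first subst.
      by move/bitangent_line_0b1/bsP: bL => h; rewrite (map_f (fun b => (0, b, 1)) h) !orbT.
    have h : (a, b) \in abs by apply/abP; split=> //; apply/bitangent_line_ab1.
    by rewrite (map_f (fun w => (w, 1)) h).
  by move/bitangent_line_m10/msP: bL => h; rewrite (map_f (fun m => (m, 1, 0)) h) !orbT.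
Qed.

Theorem theorem3p1 (r s u : algC) (smoothX : smooth_curve (quartic r s u)) :
  (exists B : seq {vspace 'rV[algC]_3},
     [/\ uniq B, size B = 28%N &
         forall L : {vspace 'rV[algC]_3},
           bitangent (quartic r s u) L <-> L \in B]) /\
  (forall L : {vspace 'rV[algC]_3}, bitangent (quartic r s u) L ->
   exists a b c : algC,
     [/\ (a, b, c) != (0, 0, 0), line_eqn L a b c,
         radical_expr r s u a, radical_expr r s u b & radical_expr r s u c]).
Proof.
have [ns [uns sns normns radns nsP]] := bitangent_normals smoothX.
split.
  exists (map line3 ns); split=> //; last by rewrite size_map.
  by rewrite map_inj_in_uniq // => n n' hn hn'; apply: line3_inj; apply: normns.
move=> L /nsP/mapP[[[a b] c] hn ->]; have [ra rb rc] := radns _ hn.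
exists a, b, c; split=> //; last exact: lineP.
apply: contraTneq (normns _ hn) => -[-> -> ->].
by rewrite unfold_in /normalized /= ![0 == 1]eq_sym oner_eq0 andbF.
Qed.
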